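(* Let $\mu$ be an infinitely divisible distribution on a complex separable Banach space $E$ with characteristic functional of the form $$\int_E e^{i\mathrm{Re}\langle z,x^*\rangle}\mu(dz)=\exp\Big(-\frac14\langle Rx^*,x^*\rangle+i\mathrm{Re}\langle\hat x,x^*\rangle+\int_E\big(e^{i\mathrm{Re}\langle z,x^*\rangle}-1-i\kappa(z)\mathrm{Re}\langle z,x^*\rangle\big)\lambda(dz)\Big),\quad x^*\in E^*.$$ For every $p\in[0,2]$ and all $x^*,y^*\in E^*$, we have the codifference bounds $$|C_\mu^{=}(x^*,y^* )|\le\frac12|\mathrm{Re}\langle Rx^*,y^*\rangle|+2^{4-p}\int_E|\mathrm{Re}\langle z,x^*\rangle\,\mathrm{Re}\langle z,y^*\rangle|^{p/2}\lambda(dz)$$ and $$|C_\mu^{\neq}(x^*,y^* )|\le\frac12|\mathrm{Im}\langle Rx^*,y^*\rangle|+2^{4-p}\int_E|\mathrm{Re}\langle z,x^*\rangle\,\mathrm{Im}\langle z,y^*\rangle|^{p/2}\lambda(dz).$$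
   Context: $E^*$ is the continuous dual of $E$ and $\langle\cdot,\cdot\rangle:E\times E^*\to\mathbb{C}$ the dual product. In the characteristic functional: $\hat x\in E$; $R:E^*\to E$ is a conjugate symmetric, positive semidefinite covariance operator (of the type $\langle Rx^*,y^*\rangle=\int_E\overline{\langle z,x^*\rangle}\langle z,y^*\rangle\,\gamma(dz)$ for a Gaussian measure $\gamma$, so $\langle Rx^*,y^*\rangle$ is conjugate-linear in $x^*$ and linear in $y^*$); $\lambda$ is a Lévy measure on $E$, i.e. $\lambda(\{0\})=0$ and $\int_E\min(1,(\mathrm{Re}\langle z,x^*\rangle)^2)\lambda(dz)<\infty$ for all $x^*\in E^*$; $\kappa$ is a truncation function, i.e. bounded measurable on $E$ with $\lim_{z\to0}\kappa(z)=1$ and $\kappa(z)=O(1/\|z\|)$ as $\|z\|\to\infty$. Codifferences. For $x^*,y^*\in E^*$, $$C^{=}_\mu(x^*,y^* ):=\log\int_E e^{i\mathrm{Re}\langle z,x^*-y^*\rangle}\mu(dz)-\log\int_E e^{i\mathrm{Re}\langle z,x^*\rangle}\mu(dz)-\log\int_E e^{-i\mathrm{Re}\langle z,y^*\rangle}\mu(dz),$$ $$C^{\neq}_\mu(x^*,y^* ):=\log\int_E e^{i\mathrm{Re}\langle z,x^*\rangle-i\mathrm{Im}\langle z,y^*\rangle}\mu(dz)-\log\int_E e^{i\mathrm{Re}\langle z,x^*\rangle}\mu(dz)-\log\int_E e^{-i\mathrm{Im}\langle z,y^*\rangle}\mu(dz),$$ where $\log$ of the characteristic functional is the exponent displayed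 in the claim; note $-\mathrm{Im}\langle z,y^*\rangle=\mathrm{Re}\langle z,iy^*\rangle$. *)

(* Defs.v *)
From HB Require Import structures.
From mathcomp Require Import all_boot all_order all_algebra.
From mathcomp Require Import all_classical all_reals all_analysis.
From mathcomp Require Import complex.

Set Implicit Arguments.
Unset Strict Implicit.
Unset Printing Implicit Defensive.

Import Order.TTheory GRing.Theory Num.Theory.
Import numFieldNormedType.Exports.
Import ComplexField.Normc.

Local Open Scope classical_set_scope.
Local Open Scope ring_scope.
Local Open Scope complex_scope.

(* The continuous dual, as a subspace of the space of all functions
   E -> R[i]; the scalar action is (a *: x)(z) = a * x(z), so that the dual
   product is bilinear. *)
Section dual.
Context {R : realType} (E : normedModType R[i]).

Definition dual_pred : {pred (E -> R[i]^o)} :=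
  fun f => `[< linear f /\ continuous f >].

Lemma dual_submod_closed : submod_closed dual_pred.
Proof.
split.
  apply/asboolP; split; first by move=> a u v; rewrite scaler0 addr0.
  exact: cst_continuous.
move=> a f g /asboolP[lf cf] /asboolP[lg cg]; apply/asboolP; split.
  move=> b u v; rewrite !fctE lf lg !scalerDr addrACA !scalerA.
  by rewrite [X in X *: f u]mulrC.
move=> z; apply: cvgD; last exact: cg.
by apply: cvgZr; exact: cf.
Qed.

HB.instance Definition _ := GRing.isSubmodClosed.Build R[i] (E -> R[i]^o)
  dual_pred dual_submod_closed.

Record dual := Dual { dual_val : E -> R[i]^o; _ : dual_val \in dual_pred }.

HB.instance Definition _ := [isSub for dual_val].
HB.instance Definition _ := [Choice of dual by <:].
HB.instance Definition _ := [SubChoice_isSubLmodule of dual by <:].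

End dual.

Definition pair {R : realType} {E : normedModType R[i]} (z : E) (x : dual E) :
  R[i] := dual_val x z.

Notation "<| z , x |>" := (pair z x) (format "<| z ,  x |>") : ring_scope.

Section pair_theory.
Context {R : realType} {E : normedModType R[i]}.
Implicit Types (x y : dual E) (z : E).

Lemma pairDr z x y : <|z, x + y|> = <|z, x|> + <|z, y|>.
Proof. by []. Qed.

Lemma pairNr z x : <|z, - x|> = - <|z, x|>.
Proof. by []. Qed.

Lemma pairZr z (a : R[i]) x : <|z, a *: x|> = a * <|z, x|>.
Proof. by []. Qed.

Lemma Re_pair_i z x : complex.Re <|z, 'i%C *: x|> = - complex.Im <|z, x|>.
Proof.
rewrite pairZr mulrC.
exact: ReiNIm.
Qed.

End pair_theory.

Definition separable_space (T : topologicalType) : Prop :=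
  exists2 D : set T, countable D & dense D.

Notation borel E := (g_sigma_algebraType (@open E)).

(* The library norm takes its (nonnegative real) values in R[i]. *)
Definition rnorm {R : realType} {E : normedModType R[i]} (z : E) : R :=
  complex.Re `|z|.

Definition cexp {R : realType} (w : R[i]) : R[i] :=
  (expR (complex.Re w))%:C *
  (cos (complex.Im w) +i* sin (complex.Im w)).

Section complex_integral.
Context d (T : measurableType d) {R : realType}.
Variable m : {measure set T -> \bar R}.

Definition Cintegral (f : T -> R[i]) : R[i] :=
  (\int[m]_t complex.Re (f t)) +i* (\int[m]_t complex.Im (f t)).

Definition Cintegrable (f : T -> R[i]) : Prop :=
  m.-integrable setT (fun t => (complex.Re (f t))%:E) /\
  m.-integrable setT (fun t => (complex.Im (f t))%:E).

End complex_integral.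

Section distributions.
Context {R : realType} {E : completeNormedModType R[i]}.
Implicit Types (mu nu gamma : probability (borel E) R) (x y : dual E).
Implicit Types (Q : dual E -> E) (xhat : E) (kappa : borel E -> R).
Implicit Types lambda : {measure set (borel E) -> \bar R}.

(* n-fold convolution power, with (nu * rho)(A) = \int rho(A - z) nu(dz). *)
Fixpoint conv_pow nu (n : nat) : set E -> \bar R :=
  if n is n'.+1 then
    fun A => (\int[nu]_z conv_pow nu n' [set w | A ((z : E) + w)%R])%E
  else fun A => \d_((0 : E) : borel E) A.

Definition infinitely_divisible mu : Prop :=
  forall n : nat, (0 < n)%N -> exists nu,
    forall A : set (borel E), measurable A -> mu A = conv_pow nu n A.

(* The library's normal_prob 0 s is not a point mass when s = 0, hence the
   separate degenerate case. *)
Definition centered_gaussian gamma : Prop :=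
  forall x,
    (exists2 s : R, 0 < s & forall A : set (measurableTypeR R), measurable A ->
       gamma [set z | A (complex.Re <|z : E, x|>)] = normal_prob 0 s A) \/
    (forall A : set (measurableTypeR R), measurable A ->
       gamma [set z | A (complex.Re <|z : E, x|>)] = \d_((0 : R) : measurableTypeR R) A).

Definition conjugate_symmetric Q : Prop :=
  forall x y, <|Q y, x|> = conjc <|Q x, y|>.

Definition positive_semidefinite Q : Prop := forall x, 0 <= <|Q x, x|>.

Definition covariance_operator Q : Prop :=
  [/\ conjugate_symmetric Q, positive_semidefinite Q &
      exists2 gamma, centered_gaussian gamma &
        forall x y, <|Q x, y|> =
          Cintegral gamma (fun z => conjc <|z : E, x|> * <|z : E, y|>)].

Definition levy_measure lambda : Prop :=
  lambda [set (0 : E)] = 0%E /\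
  forall x,
    (\int[lambda]_z (Num.min 1 (complex.Re <|z : E, x|> ^+ 2))%:E < +oo)%E.

Definition truncation_function kappa : Prop :=
  [/\ measurable_fun setT kappa,
      exists M : R, forall z, `|kappa z| <= M,
      (kappa : E -> R) @ (0 : E)^' --> (1 : R) &
      exists M C : R, forall z : E, M <= rnorm z -> `|kappa z| <= C / rnorm z].

Definition charf mu x : R[i] :=
  Cintegral mu (fun z => cexp ('i%C * (complex.Re <|z : E, x|>)%:C)).

Definition levy_integrand kappa x (z : borel E) : R[i] :=
  cexp ('i%C * (complex.Re <|z : E, x|>)%:C) - 1 -
  'i%C * (kappa z * complex.Re <|z : E, x|>)%:C.

Definition levy_exponent Q xhat lambda kappa x : R[i] :=
  - (4^-1 * <|Q x, x|>) + 'i%C * (complex.Re <|xhat, x|>)%:C +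
  Cintegral lambda (levy_integrand kappa x).

(* Integrability is what gives the integral in the exponent a meaning: it does
   not follow from [levy_measure] and [truncation_function], and the library
   integral is total. *)
Definition has_levy_khintchine_form mu Q xhat lambda kappa : Prop :=
  forall x, Cintegrable lambda (levy_integrand kappa x) /\
    charf mu x = cexp (levy_exponent Q xhat lambda kappa x).

End distributions.

(* [psi] is the logarithm of the characteristic functional of the measure: the
   log of the integral of exp(i Re<z, x>) is [psi x]. In the second codifference
   Re<z, x> - Im<z, y> = Re<z, x + 'i%C *: y>, see [Re_pair_i]. *)
Section codifference.
Context {R : realType} {E : normedModType R[i]}.
Variable psi : dual E -> R[i].
Implicit Types x y : dual E.

Definition codifference_eq x y : R[i] := psi (x - y) - psi x - psi (- y).

Definition codifference_neq x y : R[i] :=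
  psi (x + 'i%C *: y) - psi x - psi ('i%C *: y).

End codifference.

(* Main.v *)
Require Import Defs.
From mathcomp Require Import all_boot all_order all_algebra.
From mathcomp Require Import all_classical all_reals all_analysis.
From mathcomp Require Import complex.
From mathcomp Require Import measurable_realfun.
From mathcomp Require Import ring lra.

(** The Gaussian part, the drift and the jump part of the exponent contribute
    separately to psi (x - y) - psi x - psi (- y). The drift is additive and
    cancels. The covariance form is Hermitian, so by polarization only its
    cross term survives: it is Re <Q x, y> / 2
    ([covariance_form_cross_term]). In the jump part the compensators
    cancel, and the integrands combine, with a = Re <z, x> and b = Re <z, y>,
    into the product (e^(i a) - 1) (e^(- i b) - 1)
    ([levy_integrand_codifference]).

    Each factor is at most min(2, |a|), respectively min(2, |b|).
    Interpolating with exponent q = p / 2 between these two bounds gives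
    2^(1 - q) |a|^q ([normc_cexp_iB1_le]), hence 2^(2 - p) |a b|^(p / 2) for the
    product. Bounding the modulus of a complex integral through its real and
    imaginary parts costs a factor 2 ([normc_Cintegral_le]), which leaves
    2^(3 - p) <= 2^(4 - p).

    The bound with Im is the bound with Re for the functional w = - i y:
    indeed Re <z, w> = Im <z, y> for every z, in particular for z = Q x, and
    x - w = x + i y. *)

Import Order.TTheory GRing.Theory Num.Theory.
Import numFieldNormedType.Exports.

Local Open Scope classical_set_scope.
Local Open Scope ring_scope.
Local Open Scope complex_scope.

(** * Modulus and parts of a complex number *)

Section complex_modulus.
Context {R : rcfType}.
Implicit Types w : R[i].

Local Notation normc := (@ComplexField.Normc.normc R).

Lemma normc_ge0 w : 0 <= normc w.
Proof. by case: w => a b; exact: sqrtr_ge0. Qed.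

Lemma Re_le_normc w : `|complex.Re w| <= normc w.
Proof. by case: w => a b /=; rewrite -sqrtr_sqr ler_wsqrtr// lerDl sqr_ge0. Qed.

Lemma Im_le_normc w : `|complex.Im w| <= normc w.
Proof. by case: w => a b /=; rewrite -sqrtr_sqr ler_wsqrtr// lerDr sqr_ge0. Qed.

Lemma ReB w1 w2 : complex.Re (w1 - w2) = complex.Re w1 - complex.Re w2.
Proof. by case: w1 w2 => ? ? []. Qed.

Lemma ReN w : complex.Re (- w) = - complex.Re w.
Proof. by case: w. Qed.

Lemma normc_real (a : R) : normc a%:C = `|a|.
Proof. by rewrite /= expr0n addr0 sqrtr_sqr. Qed.

Lemma normc_le_ReDIm w : normc w <= `|complex.Re w| + `|complex.Im w|.
Proof.
case: w => a b /=; rewrite -(ger0_norm (addr_ge0 (normr_ge0 a) (normr_ge0 b))).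
rewrite -sqrtr_sqr ler_wsqrtr// sqrrD !real_normK ?num_real//.
by rewrite addrAC lerDl mulrn_wge0// mulr_ge0.
Qed.

End complex_modulus.

(** * The unit circle *)

Section unit_circle.
Context {R : realType}.
Implicit Types a b q : R.

Lemma cexp_i a : cexp ('i%C * a%:C) = cos a +i* sin a.
Proof.
rewrite /cexp /= !mul0r !mul1r subr0 add0r expR0.
by apply/eqP; rewrite eq_complex /= !mul1r !mul0r subr0 addr0 !eqxx.
Qed.

Lemma cexp_iB a b : cexp ('i%C * (a - b)%:C) =
  cexp ('i%C * a%:C) * cexp ('i%C * (- b)%:C).
Proof.
rewrite !cexp_i cosB sinB cosN sinN.
by apply/eqP; rewrite eq_complex /=; apply/andP; split; apply/eqP; ring.
Qed.

Lemma norm_sin_le a : `|sin a| <= `|a|.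
Proof.
wlog a0 : a / 0 <= a => [h|].
  have [/h//|/ltW a0] := leP 0 a.
  by rewrite -normrN -sinN -(normrN a) h// oppr_ge0.
have [|c _] := @MVT_segment R (@sin R) (@cos R) 0 a a0 _.
  by apply: continuous_subspaceT => x; exact: continuous_sin.
by rewrite sin0 !subr0 => ->; rewrite normrM ler_piMl// cos_max.
Qed.

(** The chord of the unit circle subtending the angle a; by the half-angle
    formulas its squared length (cos a - 1)^2 + (sin a)^2 is 4 sin^2 (a / 2). *)
Lemma normc_cexp_iB1 a :
  ComplexField.Normc.normc (cexp ('i%C * a%:C) - 1) = 2 * `|sin (a / 2)|.
Proof.
have -> : 2 * `|sin (a / 2)| = `|2 * sin (a / 2)|.
  by rewrite normrM ger0_norm.
rewrite cexp_i /= subr0 -sqrtr_sqr; congr (Num.sqrt _).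
have {1 2}-> : a = (a / 2) *+ 2 by rewrite -mulr_natr divfK.
rewrite cos_mulr2n sin_mulr2n.
have := cos2sin2 (a / 2); set c := cos _; set s := sin _ => c2.
have -> : (c * s *+ 2) ^+ 2 = 4 * s ^+ 2 * c ^+ 2 by ring.
by rewrite c2; ring.
Qed.

(** Interpolation: a number n with 0 <= n <= 2 and n <= |a| satisfies
    n = n^(1 - q) n^q <= 2^(1 - q) |a|^q. Keeping the exponent q free in [0, 1]
    is what yields a bound for every p in [0, 2]. *)
Lemma normc_cexp_iB1_le a q : 0 <= q <= 1 ->
  ComplexField.Normc.normc (cexp ('i%C * a%:C) - 1) <= 2 `^ (1 - q) * `|a| `^ q.
Proof.
move=> /andP[q0 q1]; set n := ComplexField.Normc.normc _.
have n0 : 0 <= n by exact: normc_ge0.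
have n2 : n <= 2.
  by rewrite /n normc_cexp_iB1 -[leRHS]mulr1 ler_pM2l// sin_max.
have na : n <= `|a|.
  rewrite /n normc_cexp_iB1 mulrC -ler_pdivlMr//.
  by rewrite (le_trans (norm_sin_le _))// normrM (@ger0_norm _ 2^-1).
(* n = n^1 = n^((1 - q) + q) *)
rewrite -[leLHS]powRr1// -[in leLHS](subrK q 1) powRD; last first.
  by rewrite subrK oner_eq0.
by rewrite ler_pM ?powR_ge0// ge0_ler_powR ?nnegrE ?subr_ge0.
Qed.

Lemma normc_cexp_iB1M_le a b p : 0 <= p <= 2 ->
  ComplexField.Normc.normc
    ((cexp ('i%C * a%:C) - 1) * (cexp ('i%C * (- b)%:C) - 1)) <=
  2 `^ (2 - p) * `|a * b| `^ (p / 2).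
Proof.
move=> p02; have q01 : 0 <= p / 2 <= 1 by lra.
have -> : 2 - p = (1 - p / 2) + (1 - p / 2) by field.
rewrite powRD ?pnatr_eq0 ?implybT// normrM powRM// mulrACA.
rewrite ComplexField.Normc.normcM ler_pM ?normc_ge0 ?normc_cexp_iB1_le//.
by rewrite -(normrN b) normc_cexp_iB1_le.
Qed.

End unit_circle.

(** * Complex-valued integrals *)

Section complex_integral_theory.
Context d (T : measurableType d) {R : realType}.
Variable m : {measure set T -> \bar R}.
Implicit Types f g : T -> R[i].

Lemma CintegrableB f g : Cintegrable m f -> Cintegrable m g ->
  Cintegrable m (fun t => f t - g t).
Proof.
move=> [f1 f2] [g1 g2]; split.
- rewrite (_ : (fun t => _) =
    (fun t => (complex.Re (f t))%:E - (complex.Re (g t))%:E)%E).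
    exact: integrableB.
  by apply/funext => t; rewrite -EFinB; case: (f t) (g t) => ? ? [].
- rewrite (_ : (fun t => _) =
    (fun t => (complex.Im (f t))%:E - (complex.Im (g t))%:E)%E).
    exact: integrableB.
  by apply/funext => t; rewrite -EFinB; case: (f t) (g t) => ? ? [].
Qed.

Lemma CintegralB f g : Cintegrable m f -> Cintegrable m g ->
  Cintegral m (fun t => f t - g t) = Cintegral m f - Cintegral m g.
Proof.
move=> [f1 f2] [g1 g2]; apply/eqP; rewrite eq_complex /=.
rewrite -!RintegralB//; apply/andP; split; apply/eqP;
  by apply: eq_Rintegral => t _; case: (f t) (g t) => ? ? [].
Qed.

(** The two parts are estimated separately, whence the factor 2: the sharp
    inequality would need a rotation of the integral to the real axis. The
    bound is an extended real, so that it makes sense when g has infinite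
    integral. *)
Lemma normc_Cintegral_le f (g : T -> R) : Cintegrable m f ->
  measurable_fun setT g ->
  (forall t, ComplexField.Normc.normc (f t) <= g t) ->
  ((ComplexField.Normc.normc (Cintegral m f))%:E <=
     2%:E * \int[m]_t (g t)%:E)%E.
Proof.
move=> [f1 f2] mg fg.
have part (h : T -> R) : m.-integrable setT (EFin \o h) ->
    (forall t, `|h t| <= g t) ->
    (`|\int[m]_t h t|%:E <= \int[m]_t (g t)%:E)%E.
  move=> ih hg; rewrite EFin_normr_Rintegral//.
  have mh := measurable_int _ ih.
  apply: (le_trans (le_abse_integral _ _ mh)) => //.
  apply: ge0_le_integral => //.
  - exact: measurableT_comp mh.
  - exact/measurable_EFinP.
  - by move=> t _; rewrite lee_fin hg.
rewrite mule_natl mule2n.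
have := normc_le_ReDIm (Cintegral m f); rewrite -lee_fin => /le_trans; apply.
rewrite EFinD; apply: leeD; apply: part => // t.
- exact: le_trans (Re_le_normc _) (fg t).
- exact: le_trans (Im_le_normc _) (fg t).
Qed.

End complex_integral_theory.

(** * Borel measurability of continuous functionals *)

Section dual_measurability.
Context {R : realType}.

Lemma Re_continuous : continuous (@complex.Re R : R[i]^o -> R).
Proof.
move=> w; have nw : Filter (nbhs (w : R[i]^o)) := nbhs_filter _.
apply/cvgrPdist_lt => e e0.
have e0' : 0 < e%:C by rewrite ltcR.
have := @cvgr_dist_lt _ R[i]^o _ _ nw id w cvg_id _ e0'.
apply: (@filterS _ _ nw) => v; rewrite normc_def ltcR; apply: le_lt_trans.
have := Re_le_normc (w - v).
by case: (w) (v) => [? ?] [? ?].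
Qed.

(** The Borel sigma-algebra of E is generated by the open sets, so continuity of
    the functional suffices. *)
Lemma measurable_Re_pair (E : completeNormedModType R[i]) (x : dual E) :
  measurable_fun [set: borel E] (fun z => complex.Re <|z : E, x|>).
Proof.
apply: (measurability _ (RGenOpens.measurableE R)).
move=> _ [_ [a [b ->] <-]]; rewrite setTI; apply: sub_sigma_algebra.
have cx : continuous (dual_val x).
  by have /asboolP[] : dual_val x \in @dual_pred R E by exact: (valP x).
have /continuousP cRe : continuous (fun z : E => complex.Re (dual_val x z)).
  by move=> z; apply: continuous_comp; [exact: cx|exact: Re_continuous].
exact/cRe/interval_open.
Qed.

End dual_measurability.

(** * Codifferences of a Lévy-Khintchine exponent *)

Section codifference_bound.
Context {R : realType} {E : completeNormedModType R[i]}.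
Variables (Q : dual E -> E) (xhat : E).
Variables (lambda : {measure set (borel E) -> \bar R}) (kappa : borel E -> R).
Implicit Types x y : dual E.

(** Conjugate symmetry plays the role of additivity of Q: <Q u, v> is the
    conjugate of <Q v, u>, which is linear in u. The diagonal term at y appears
    twice as the same conjugate, and the one at x is real by positivity. *)
Lemma covariance_form_cross_term x y :
  conjugate_symmetric Q -> positive_semidefinite Q ->
  <|Q (x - y), x - y|> - <|Q x, x|> - <|Q (- y), - y|> =
  - (2 * complex.Re <|Q x, y|>)%:C.
Proof.
move=> cQ pQ.
have Qsub : <|Q (x - y), x - y|> =
    conjc (<|Q x, x|> - <|Q x, y|> - (<|Q y, x|> - <|Q y, y|>)).
  rewrite pairDr pairNr (cQ x) (cQ y) !pairDr !pairNr.
  by rewrite -rmorphB.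
have QN : <|Q (- y), - y|> = conjc <|Q y, y|>.
  by rewrite pairNr (cQ y) pairNr rmorphN opprK.
rewrite Qsub QN (cQ x y).
have := pQ x; rewrite lecE /= => /andP[/eqP + _].
case: <|Q x, x|> => a a' /= ->; case: <|Q x, y|> => b b'.
case: <|Q y, y|> => c c'.
by apply/eqP; rewrite eq_complex /=; apply/andP; split; apply/eqP; ring.
Qed.

(** The compensator is additive in x and drops out; what remains is
    e^(i(a - b)) - e^(ia) - e^(-ib) + 1, which factors. *)
Lemma levy_integrand_codifference x y z :
  codifference_eq (fun x => levy_integrand kappa x z) x y =
  (cexp ('i%C * (complex.Re <|z : E, x|>)%:C) - 1) *
  (cexp ('i%C * (- complex.Re <|z : E, y|>)%:C) - 1).
Proof.
rewrite /codifference_eq /levy_integrand pairDr pairNr ReB ReN cexp_iB.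
set a := complex.Re _; set b := complex.Re _.
have -> : (kappa z * (a - b))%:C = (kappa z * a)%:C + (kappa z * - b)%:C.
  by rewrite -rmorphD mulrBr mulrN.
by ring.
Qed.

Lemma codifference_eq_levy_exponent x y :
  conjugate_symmetric Q -> positive_semidefinite Q ->
  (forall x, Cintegrable lambda (levy_integrand kappa x)) ->
  codifference_eq (levy_exponent Q xhat lambda kappa) x y =
  (2^-1 * complex.Re <|Q x, y|>)%:C +
  Cintegral lambda
    (fun z => codifference_eq (fun x => levy_integrand kappa x z) x y).
Proof.
move=> cQ pQ iL.
rewrite /codifference_eq CintegralB//; last exact: CintegrableB.
rewrite CintegralB// /levy_exponent (pairDr xhat) (pairNr xhat) ReB ReN.
set a := complex.Re _; set b := complex.Re _.
have -> : (a - b)%:C = a%:C - b%:C by rewrite rmorphB.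
have -> : (- b)%:C = - b%:C by rewrite rmorphN.
have -> : (2^-1 * complex.Re <|Q x, y|>)%:C =
    4^-1 * (2 * complex.Re <|Q x, y|>)%:C.
  rewrite (_ : 4^-1 = (4^-1)%:C) -?rmorphM; last by rewrite fmorphV rmorph_nat.
  by congr (_ %:C); field.
have /eqP := covariance_form_cross_term x y cQ pQ.
rewrite -eqr_oppLR => /eqP <-.
by ring.
Qed.

Lemma codifference_eq_le x y p :
  conjugate_symmetric Q -> positive_semidefinite Q ->
  (forall x, Cintegrable lambda (levy_integrand kappa x)) ->
  0 <= p <= 2 ->
  ((ComplexField.Normc.normc
      (codifference_eq (levy_exponent Q xhat lambda kappa) x y))%:E
    <= (2^-1 * `|complex.Re <|Q x, y|>|)%:E +
       (2 `^ (4 - p))%:E *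
       \int[lambda]_z
         (`|complex.Re <|z : E, x|> * complex.Re <|z : E, y|>| `^ (p / 2))%:E)%E.
Proof.
move=> cQ pQ iL p02.
rewrite codifference_eq_levy_exponent//.
pose g z := `|complex.Re <|z : E, x|> * complex.Re <|z : E, y|>| `^ (p / 2).
have mg : measurable_fun [set: borel E] g.
  apply: (measurableT_comp (measurable_powR _)).
  apply: measurableT_comp => //.
  by apply: measurable_funM; exact: measurable_Re_pair.
have int_le : ((ComplexField.Normc.normc (Cintegral lambda
    (fun z => codifference_eq (fun x => levy_integrand kappa x z) x y)))%:E <=
    2%:E * \int[lambda]_z (2 `^ (2 - p) * g z)%:E)%E.
  apply: normc_Cintegral_le.
  - by apply: CintegrableB => //; exact: CintegrableB.
  - exact: measurable_funM.
  - by move=> z; rewrite levy_integrand_codifference normc_cexp_iB1M_le.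
apply: (@le_trans _ _ (_ + _)%:E); first by rewrite lee_fin; exact: le_normcD.
rewrite EFinD; apply: leeD.
  by rewrite lee_fin normc_real normrM ger0_norm.
apply: (le_trans int_le).
under eq_integral do rewrite EFinM.
rewrite ge0_integralZl_EFin ?powR_ge0//; last 2 first.
  by move=> z _; rewrite lee_fin powR_ge0.
  exact/measurable_EFinP.
rewrite muleA -EFinM lee_wpmul2r//.
  by apply: integral_ge0 => z _; rewrite lee_fin powR_ge0.
(* Of the available factor 4 = 2^2, only 2 is used. *)
have -> : 4 - p = 2 + (2 - p) by ring.
rewrite lee_fin (@powRD _ 2 2 (2 - p)) ?pnatr_eq0 ?implybT// ler_wpM2r ?powR_ge0//.
by rewrite powR_mulrn// expr2 ler_peMl// ler1n.
Qed.

End codifference_bound.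

Theorem lemma3p1 (R : realType) (E : completeNormedModType R[i])
  (mu : probability (borel E) R) (Q : dual E -> E) (xhat : E)
  (lambda : {measure set (borel E) -> \bar R}) (kappa : borel E -> R) :
  separable_space E ->
  infinitely_divisible mu ->
  covariance_operator Q ->
  levy_measure lambda ->
  truncation_function kappa ->
  has_levy_khintchine_form mu Q xhat lambda kappa ->
  forall p : R, 0 <= p <= 2 -> forall x y : dual E,
    ((ComplexField.Normc.normc
        (codifference_eq (levy_exponent Q xhat lambda kappa) x y))%:E
      <= (2^-1 * `|complex.Re <|Q x, y|>|)%:E +
         (2 `^ (4 - p))%:E *
         \int[lambda]_z
           (`|complex.Re <|z : E, x|> * complex.Re <|z : E, y|>| `^ (p / 2))%:E)%E
    /\
    ((ComplexField.Normc.normc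
        (codifference_neq (levy_exponent Q xhat lambda kappa) x y))%:E
      <= (2^-1 * `|complex.Im <|Q x, y|>|)%:E +
         (2 `^ (4 - p))%:E *
         \int[lambda]_z
           (`|complex.Re <|z : E, x|> * complex.Im <|z : E, y|>| `^ (p / 2))%:E)%E.
Proof.
move=> _ _ [cQ pQ _] _ _ LK p p02 x y.
have iL x' : Cintegrable lambda (levy_integrand kappa x') by have [] := LK x'.
split; first exact: codifference_eq_le.
(* Apply the first bound to w = - i y, for which Re <z, w> = Im <z, y>. *)
have := @codifference_eq_le _ _ Q xhat _ _ x (- ('i%C *: y)) p cQ pQ iL p02.
have Re_turn z : complex.Re <|z, - ('i%C *: y)|> = complex.Im <|z, y|>.
  by rewrite pairNr raddfN /= Re_pair_i opprK.
rewrite Re_turn; under eq_integral do rewrite Re_turn.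
by rewrite /codifference_eq opprK.
Qed.
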